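(* The average search probability on the complete graph $K_n$ (with any marked vertex $a$) approaches $1/4$ as $n\to\infty$.
   Context: Quantum walk: let $X$ be a $k$-regular graph on $n$ vertices with marked vertex $a$ (for $X=K_n$, $k=n-1$). View each edge $\{u,v\}$ as two arcs $(u,v),(v,u)$ and consider complex functions on the $nk$ arcs, identified with $\mathbb{C}^n\otimes\mathbb{C}^k$ by grouping arcs by tail. Let $R$ be the permutation matrix swapping $(u,v)$ and $(v,u)$, $C=I_n\otimes(\frac2kJ_k-I_k)$ (i.e. $(Cf)(u,v)=\frac2k\sum_{w\sim u}f(u,w)-f(u,v)$), and $O_a=(I_n-2E_{aa})\otimes I_k$ (i.e. $O_a$ multiplies $f(u,v)$ by $-1$ if $u=a$ and by $1$ otherwise). The transition matrix is $U=RCO_a$ and the initial state is $x_0=\frac{1}{\sqrt{nk}}\mathbf{1}_{nk}$, where $\mathbf 1_{nk}$ is the all-ones vector. If $F_r$ are the orthogonal projections onto the eigenspaces of $U$ (one for each distinct eigenvalue), the average search probability is $$\sum_{v\sim a}\sum_r\big|e_{(a,v)}^TF_rx_0\big|^2,$$ which equals $\lim_{T\to\infty}\frac1T\sum_{t=0}^{T-1}\sum_{v\sim a}|e_{(a,v)}^TU^tx_0|^2$. *)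

(* Defs.v *)
From HB Require Import structures.
From mathcomp Require Import all_boot all_order all_algebra.
From mathcomp Require Import complex.
From mathcomp Require Import all_classical all_reals all_analysis.
Set Implicit Arguments.
Unset Strict Implicit.
Unset Printing Implicit Defensive.

Import Order.TTheory GRing.Theory Num.Theory.
Import numFieldNormedType.Exports.
Local Open Scope ring_scope.
Local Open Scope complex_scope.

Record regular_graph (V : finType) (k : nat) := RegularGraph {
  adj :> rel V;
  adj_sym : symmetric adj;
  adj_irr : irreflexive adj;
  adj_regular : forall u : V, #|[pred v | adj u v]| = k }.

Fact complete_adj_sym n : symmetric (fun u v : 'I_n => u != v).
Proof. by move=> u v; rewrite eq_sym. Qed.

Fact complete_adj_irr n : irreflexive (fun u v : 'I_n => u != v).
Proof. by move=> u; rewrite eqxx. Qed.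

Fact complete_adj_regular n (u : 'I_n) : #|[pred v | u != v]| = n.-1.
Proof.
by rewrite -[n in RHS]card_ord -(cardC1 u); apply: eq_card => v;
  rewrite !inE eq_sym.
Qed.

Definition complete_graph (n : nat) : regular_graph 'I_n n.-1 :=
  RegularGraph (@complete_adj_sym n) (@complete_adj_irr n)
    (@complete_adj_regular n).

(* The arc (u, v) has tail u and head v. *)
Definition arc (V : finType) (k : nat) (X : regular_graph V k) : finType :=
  {p : V * V | X p.1 p.2}.

Definition tail (V : finType) (k : nat) (X : regular_graph V k) (p : arc X) : V :=
  (val p).1.

Definition head (V : finType) (k : nat) (X : regular_graph V k) (p : arc X) : V :=
  (val p).2.

Section SpectralProjections.
Variables (C : numClosedFieldType) (m : nat).
Implicit Types A : 'M[C]_m.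

Definition eigenvalues A : seq C :=
  undup (sval (closed_field_poly_normal (char_poly A))).

Lemma mem_eigenvalues A r : (r \in eigenvalues A) = eigenvalue A r.
Proof.
rewrite /eigenvalues mem_undup eigenvalue_root_char.
case: closed_field_poly_normal => s /= ->.
by rewrite (monicP (char_poly_monic A)) scale1r root_prod_XsubC.
Qed.

(* [eigenspace] and [proj_ortho] act on row vectors.  The rows spanning
   [eigenspace A^T r] are the transposes of the columns x with A x = r x, so
   the outer transpose gives the projection acting on column vectors. *)
Definition eigenproj A (r : C) : 'M[C]_m :=
  (proj_ortho (eigenspace A^T r))^T.

End SpectralProjections.

Section QuantumWalk.
Variables (R : realType) (V : finType) (k : nat) (X : regular_graph V k).
Variable a : V.

(* Operators on complex functions on arcs, as matrices acting on columns
   through the enumeration of the arcs. *)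
Definition arc_mx (K : arc X -> arc X -> R[i]) : 'M[R[i]]_#|arc X| :=
  \matrix_(i, j) K (enum_val i) (enum_val j).

Definition arc_reversal : 'M[R[i]]_#|arc X| :=
  arc_mx (fun p q => ((tail p == head q) && (head p == tail q))%:R).

Definition coin : 'M[R[i]]_#|arc X| :=
  arc_mx (fun p q => 2 / k%:R * (tail p == tail q)%:R - (p == q)%:R).

Definition oracle : 'M[R[i]]_#|arc X| :=
  arc_mx (fun p q => (if tail p == a then -1 else 1) * (p == q)%:R).

Definition transition : 'M[R[i]]_#|arc X| := arc_reversal *m coin *m oracle.

Definition initial_state : 'cV[R[i]]_#|arc X| :=
  const_mx ((Num.sqrt (#|V| * k)%:R)^-1 : R)%:C.

Definition arc_vec (p : arc X) : 'cV[R[i]]_#|arc X| :=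
  delta_mx (enum_rank p) 0.

Definition avg_search_prob : R :=
  \sum_(p : arc X | tail p == a) \sum_(r <- eigenvalues transition)
    Normc.normc
      (((arc_vec p)^T *m eigenproj transition r *m initial_state) 0 0) ^+ 2.

End QuantumWalk.

(* Main.v *)
Require Import Defs.
From mathcomp Require Import all_boot all_order all_algebra.
From mathcomp Require Import complex ring lra.
From mathcomp Require Import all_classical all_reals all_analysis.
Import Defs.
Import Order.TTheory GRing.Theory Num.Theory.
Import numFieldNormedType.Exports.
Local Open Scope classical_set_scope.
Local Open Scope ring_scope.
Set Implicit Arguments.
Unset Strict Implicit.
Unset Printing Implicit Defensive.

(** The probability has a closed form, and the limit is read off from it: on
    the complete graph with [n + 1] vertices, [n > 0], and with [h = 1 / n], it
    is [(1 + h (1 - h)^2) / ((1 + h) (2 - h)^2)] ([avg_search_prob_complete]),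
    which tends to 1/4 as [h] tends to 0.

    The transition matrix is unitary, so its eigenspaces are pairwise
    orthogonal.  Hence, once the initial state is written as a sum of
    eigenvectors for distinct eigenvalues, the summands are its spectral
    components, and every other eigenprojection kills it ([sum_eigenproj]).

    By symmetry the initial state stays among the vectors that are constant on
    the three classes of arcs: those leaving the marked vertex, those entering
    it, and the rest.  With [c = 1 - 2 / n], the walk acts on the values
    [(al, be, ga)] on these classes by
    [(al, be, ga) |-> ((1 + c) ga - c be, - al, (1 - c) be + c ga)],
    whose characteristic polynomial is [(z + 1) (z^2 - (1 + c) z + 1)].  Its
    roots are [-1] and two conjugate numbers [l], [m] of modulus 1 with real
    part [(1 + c) / 2 = 1 - h].  Explicit eigenvectors ([class_eigenvec],
    [class_eigenvecN1]) and the resulting decomposition of the constant vector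
    ([class_vec_decomp]) give the three amplitudes on the arcs leaving the
    marked vertex.  The eigenvalues [l] and [m] contribute 1/8 each to the limit,
    and [-1] contributes nothing. *)

(** * Spectral components of a vector under a unitary matrix *)

Section UnitaryEigenvectors.
Variables (C : numClosedFieldType) (m : nat).
Implicit Types (A : 'M[C]_m) (u v : 'rV[C]_m) (x : 'cV[C]_m) (r t : C).
Local Open Scope sesquilinear_scope.

(** A unitary matrix preserves inner products, while on two eigenvectors it
    scales them by the eigenvalues.  Both facts about unitary matrices below
    come from comparing the two. *)
Lemma unitary_eigen_scale A u v r t : A \is unitarymx ->
  u *m A = r *: u -> v *m A = t *: v ->
  u *m v ^t* = (r * t^*) *: (u *m v ^t*).
Proof.
move=> /unitarymxP A1 uA vA.
rewrite -[u in LHS]mulmx1 -A1 !mulmxA uA -mulmxA -map_mxM -trmx_mul vA.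
by rewrite linearZ /= map_mxZ -scalemxAl -scalemxAr scalerA.
Qed.

Lemma unitary_eigenvalue_norm A v t : A \is unitarymx -> v != 0 ->
  v *m A = t *: v -> t * t^* = 1.
Proof.
move=> AU v0 vA; have := unitary_eigen_scale AU vA vA.
have : v *m v ^t* != 0.
  apply: contra v0 => /eqP/orthomx1P/orthomx_disj vv.
  by rewrite -submx0 -vv sub_capmx submx_refl.
move=> vv0 /eqP; rewrite -subr_eq0 -{1}[_ *m _]scale1r -scalerBl scaler_eq0.
by rewrite (negPf vv0) orbF subr_eq0 eq_sym => /eqP.
Qed.

Lemma unitary_eigen_ortho A u v r t : A \is unitarymx -> r != t ->
  u *m A = r *: u -> v *m A = t *: v -> u *m v ^t* = 0.
Proof.
move=> AU rt uA vA; have [->|v0] := eqVneq v 0.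
  by rewrite trmx0 map_mx0 mulmx0.
have uv := unitary_eigen_scale AU uA vA.
have tt := unitary_eigenvalue_norm AU v0 vA.
suff : (t - r) *: (u *m v ^t*) = 0.
  by move/eqP; rewrite scaler_eq0 subr_eq0 eq_sym (negPf rt) => /eqP.
rewrite scalerBl {1}uv scalerA mulrCA tt mulr1 subrr//.
Qed.

Lemma tr_eigenP A x r : A *m x = r *: x -> x^T *m A^T = r *: x^T.
Proof. by rewrite -trmx_mul => ->; rewrite linearZ. Qed.

Lemma eigenproj_id A x r : A *m x = r *: x -> eigenproj A r *m x = x.
Proof.
move=> /tr_eigenP xA; rewrite -[RHS]trmxK -[in LHS](trmxK x) -trmx_mul.
by rewrite proj_ortho_id //; apply/eigenspaceP.
Qed.

Lemma eigenproj_eq0 A x r t : A \is unitarymx -> r != t ->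
  A *m x = t *: x -> eigenproj A r *m x = 0.
Proof.
move=> AU rt /tr_eigenP xA; rewrite -(trmxK x) -trmx_mul.
rewrite proj_ortho_0 ?trmx0//; apply/orthomxP => u v ux /eigenspaceP vA.
apply/orthomx1P.
apply: (@unitary_eigen_ortho A^T _ _ t r); rewrite 1?eq_sym ?trmx_unitary//.
by case/sub_rVP: ux => c ->; rewrite -scalemxAl xA !scalerA mulrC.
Qed.

Lemma char_poly_trmx A : char_poly A^T = char_poly A.
Proof.
rewrite /char_poly -det_tr /char_poly_mx linearB /= tr_scalar_mx map_trmx.
by rewrite trmxK.
Qed.

(** The form in which spectral components enter the search probability.  The
    vectors [y r] may vanish: then [r] need not be an eigenvalue, so [s] and the
    spectrum may each contain values missing from the other, and [phi 0 = 0]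
    makes all these terms disappear. *)
Lemma sum_eigenproj (W : nmodType) A (s : seq C) (y : C -> 'cV[C]_m) x
    (phi : 'cV[C]_m -> W) :
  A \is unitarymx -> uniq s -> {in s, forall r, A *m y r = r *: y r} ->
  x = \sum_(r <- s) y r -> phi 0 = 0 ->
  \sum_(r <- eigenvalues A) phi (eigenproj A r *m x) = \sum_(r <- s) phi (y r).
Proof.
move=> AU us yA -> phi0.
have projy r :
    eigenproj A r *m (\sum_(t <- s) y t) = if r \in s then y r else 0.
  rewrite mulmx_sumr; case: ifPn => rs.
    rewrite (bigD1_seq r) //= eigenproj_id ?yA// big_seq_cond.
    rewrite big1 ?addr0// => t /andP[ts tr].
    by apply: eigenproj_eq0 (yA _ ts); rewrite // eq_sym.
  rewrite big_seq big1 // => t ts; apply: eigenproj_eq0 (yA _ ts) => //.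
  by apply: contraNneq rs => ->.
transitivity (\sum_(r <- eigenvalues A | r \in s) phi (y r)).
  by rewrite [RHS]big_mkcond; apply: eq_bigr => r _; rewrite projy; case: ifP.
rewrite -big_filter.
rewrite [RHS](bigID (mem (eigenvalues A)))/= [X in _ = _ + X]big_seq_cond.
rewrite [X in _ = _ + X]big1 ?addr0 => [|r /andP[rs]].
  rewrite -[RHS]big_filter; apply: perm_big; apply: uniq_perm.
  - by rewrite filter_uniq// undup_uniq.
  - by rewrite filter_uniq.
  - by move=> r; rewrite !mem_filter andbC.
(* [eigenvalue] refers to row vectors and [y r] is a column, hence the detour
   through the transpose. *)
rewrite mem_eigenvalues => /negP re; have [->//|y0] := eqVneq (y r) 0.
case: re; rewrite eigenvalue_root_char -char_poly_trmx -eigenvalue_root_char.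
apply/eigenvalueP; exists (y r)^T; first exact/tr_eigenP/yA.
by rewrite -trmx0 (inj_eq trmx_inj).
Qed.

End UnitaryEigenvectors.

(** * The walk as an operator on functions of arcs *)

Section Arcs.
Variables (R : realType) (V : finType) (k : nat) (X : regular_graph V k).
Local Notation C := (R[i])%C.
Implicit Types (p q : arc X) (f : arc X -> C) (K : arc X -> arc X -> C).

Lemma arc_eqE p q : (p == q) = (tail p == tail q) && (head p == head q).
Proof. by case: p q => [[u v] uv] [[w z] wz]. Qed.

Definition flip p : arc X :=
  exist _ (head p, tail p) (etrans (adj_sym X _ _) (valP p)).

(** An arc with tail [u] is the same as a neighbour of [u]. *)
Lemma sum_arcs_from (W : nmodType) (u : V) (F : V -> V -> W) :
  \sum_(p : arc X | tail p == u) F (tail p) (head p) = \sum_(v | X u v) F u v.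
Proof.
rewrite [RHS](reindex_omap (fun p : arc X => head p)
  (fun v => insub (u, v))) /=.
  apply: eq_big => [p|p /eqP-> //].
  apply/eqP/andP => [<-|[uv]].
    have eq_p : (tail p, head p) = val p by rewrite [RHS]surjective_pairing.
    by rewrite eq_p valK (valP p) eqxx.
  by rewrite insubT => /eqP[<-].
by move=> v uv; rewrite insubT.
Qed.

Lemma card_arcs_from (u : V) : (\sum_(p : arc X | tail p == u) 1 = k)%N.
Proof. by rewrite (sum_arcs_from u (fun _ _ => 1%N)) sum1_card adj_regular. Qed.

Definition func_vec f : 'cV[C]_#|arc X| := \col_i f (enum_val i).

Lemma eq_func_vec f g : f =1 g -> func_vec f = func_vec g.
Proof. by move=> fg; apply/matrixP => i j; rewrite !mxE. Qed.

Lemma func_vec_entry f p : ((arc_vec R p)^T *m func_vec f) 0 0 = f p.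
Proof. by rewrite trmx_delta -rowE !mxE enum_rankK. Qed.

Lemma arc_mx_func_vec K f :
  arc_mx K *m func_vec f = func_vec (fun p => \sum_q K p q * f q).
Proof.
apply/matrixP => i j; rewrite !mxE [RHS](reindex (@enum_val _ (arc X))) /=.
  by apply: eq_bigr => l _; rewrite !mxE.
exact/onW_bij/enum_val_bij.
Qed.

(** Every column vector is a [func_vec], so the operators of the walk can be
    compared through their action on functions. *)
Lemma mx_eq_on_func_vec (A B : 'M[C]_#|arc X|) :
  (forall f, A *m func_vec f = B *m func_vec f) -> A = B.
Proof.
move=> AB; apply: trmx_inj; apply/row_matrixP => i.
rewrite -!tr_col !colE; congr trmx.
have -> : delta_mx i 0 = func_vec (fun p => (enum_rank p == i)%:R).
  by apply/matrixP => j l; rewrite !mxE ord1 enum_valK andbT.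
exact: AB.
Qed.

Lemma reversal_func_vec f :
  arc_reversal R X *m func_vec f = func_vec (f \o flip).
Proof.
rewrite arc_mx_func_vec; apply: eq_func_vec => p /=.
rewrite (bigD1 (flip p)) //= !eqxx mul1r big1 ?addr0 // => q.
rewrite arc_eqE /= => qp.
by rewrite andbC eq_sym (eq_sym _ (head q)) (negPf qp) mul0r.
Qed.

Lemma coin_func_vec f : coin R X *m func_vec f =
  func_vec (fun p => 2 / k%:R * (\sum_(q | tail q == tail p) f q) - f p).
Proof.
rewrite arc_mx_func_vec; apply: eq_func_vec => p.
under eq_bigr do rewrite mulrBl -[_ * _ * f _]mulrA.
rewrite big_split /= -mulr_sumr sumrN; congr (_ * _ - _).
  rewrite [RHS]big_mkcond; apply: eq_bigr => q _; rewrite eq_sym.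
  by case: eqP => _; rewrite ?mul1r ?mul0r.
rewrite (bigD1 p) //= eqxx mul1r big1 ?addr0 // => q qp.
by rewrite eq_sym (negPf qp) mul0r.
Qed.

Lemma oracle_func_vec (a : V) f : oracle R X a *m func_vec f =
  func_vec (fun p => (if tail p == a then -1 else 1) * f p).
Proof.
rewrite arc_mx_func_vec; apply: eq_func_vec => p.
rewrite (bigD1 p) //= eqxx mulr1 big1 ?addr0 // => q qp.
by rewrite [p == q]eq_sym (negPf qp) mulr0 mul0r.
Qed.

(** The coin averages over the arcs with a common tail, on which the oracle has
    a constant sign; the sign therefore factors out. *)
Lemma transition_func_vec (a : V) f : transition R X a *m func_vec f =
  func_vec (fun p => (if head p == a then -1 else 1) *
    (2 / k%:R * (\sum_(q | tail q == head p) f q) - f (flip p))).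
Proof.
rewrite -!mulmxA oracle_func_vec coin_func_vec reversal_func_vec.
apply: eq_func_vec => p /=; rewrite mulrBr mulrCA; congr (_ * _ - _).
by rewrite mulr_sumr; apply: eq_bigr => q /eqP->.
Qed.

(** Used for reversal, coin and oracle, each a Hermitian involution. *)
Lemma arc_mx_unitary K : (forall p q, (K p q)^*%R = K q p) ->
  arc_mx K *m arc_mx K = 1%:M -> arc_mx K \is unitarymx.
Proof.
move=> KH KK; apply/unitarymxP; rewrite -[RHS]KK; congr (_ *m _).
by apply/matrixP => i j; rewrite !mxE KH.
Qed.

Lemma reversal_unitary : arc_reversal R X \is unitarymx.
Proof.
apply: arc_mx_unitary => [p q|].
  by rewrite conjC_nat andbC eq_sym [in X in _ && X]eq_sym.
apply: mx_eq_on_func_vec => f; rewrite mul1mx -mulmxA !reversal_func_vec.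
by apply: eq_func_vec => p /=; congr f; apply/eqP; rewrite arc_eqE !eqxx.
Qed.

(** The sum of [f] over the arcs with a common tail is unchanged by the coin,
    since it becomes [(2 / k) k - 1] times itself. *)
Lemma coin_unitary : (0 < k)%N -> coin R X \is unitarymx.
Proof.
move=> k_gt0; have k0 : k%:R != 0 :> C by rewrite pnatr_eq0 -lt0n.
apply: arc_mx_unitary => [p q|].
  rewrite rmorphB !rmorphM fmorphV /= !conjC_nat.
  by rewrite (eq_sym p) (eq_sym (tail p)).
apply: mx_eq_on_func_vec => f; rewrite mul1mx -mulmxA !coin_func_vec.
apply: eq_func_vec => p; set S := \sum_(q | tail q == tail p) f q.
have -> : \sum_(q | tail q == tail p)
    (2 / k%:R * (\sum_(l | tail l == tail q) f l) - f q) =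
    2 / k%:R * S *+ k - S.
  rewrite big_split sumrN /= -/S; congr (_ - _).
  under eq_bigr => q /eqP-> do [].
  by rewrite -/S sumr_const -sum1_card card_arcs_from.
by rewrite -mulr_natr; field.
Qed.

Lemma oracle_unitary (a : V) : oracle R X a \is unitarymx.
Proof.
apply: arc_mx_unitary => [p q|].
  rewrite rmorphM /= conjC_nat [q == p]eq_sym.
  have [->|] := eqVneq p q; last by rewrite !mulr0.
  by case: ifP; rewrite ?rmorphN rmorph1.
apply: mx_eq_on_func_vec => f; rewrite mul1mx -mulmxA !oracle_func_vec.
by apply: eq_func_vec => p; case: ifP; rewrite ?mul1r // !mulN1r opprK.
Qed.

Lemma transition_unitary (a : V) :
  (0 < k)%N -> transition R X a \is unitarymx.
Proof.
move=> k_gt0; rewrite /transition !mul_unitarymx //.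
- exact: reversal_unitary.
- exact: coin_unitary.
- exact: oracle_unitary.
Qed.

End Arcs.

(** * The three-dimensional walk on the complete graph *)

Section CompleteGraph.
Variables (R : realType) (n : nat) (a : 'I_n.+1).
Hypothesis n_gt0 : (0 < n)%N.
Local Notation C := (R[i])%C.
Local Notation X := (complete_graph n.+1).
Local Notation U := (transition R X a).
Implicit Types (al be ga l m : C).

Definition class_fun al be ga (u v : 'I_n.+1) : C :=
  if u == a then al else if v == a then be else ga.

Definition class_vec al be ga : 'cV[C]_#|arc X| :=
  func_vec (fun p => class_fun al be ga (tail p) (head p)).

Lemma class_vec_entry al be ga (p : arc X) : tail p = a ->
  ((arc_vec R p)^T *m class_vec al be ga) 0 0 = al.
Proof. by move=> pa; rewrite func_vec_entry /class_fun pa eqxx. Qed.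

Lemma class_vecD al be ga al' be' ga' :
  class_vec al be ga + class_vec al' be' ga' =
  class_vec (al + al') (be + be') (ga + ga').
Proof.
by apply/matrixP => i j; rewrite !mxE /class_fun; repeat case: ifP => _.
Qed.

Lemma class_vecZ t al be ga :
  t *: class_vec al be ga = class_vec (t * al) (t * be) (t * ga).
Proof.
by apply/matrixP => i j; rewrite !mxE /class_fun; repeat case: ifP => _.
Qed.

Lemma sum_class_fun al be ga (u : 'I_n.+1) :
  \sum_(p : arc X | tail p == u) class_fun al be ga (tail p) (head p) =
  if u == a then al *+ n else ga *+ n + (be - ga).
Proof.
rewrite (sum_arcs_from X u (class_fun al be ga)) /class_fun.
have [->|ua] := eqVneq u a; first by rewrite sumr_const complete_adj_regular.
have -> : ga *+ n = \sum_(v | u != v) ga.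
  by rewrite sumr_const complete_adj_regular.
rewrite (bigD1 a) //= [X in _ = X + _](bigD1 a) //= eqxx.
rewrite addrAC (addrC ga) subrK; congr (_ + _).
by apply: eq_bigr => v /andP[_ /negPf->].
Qed.

Let c : C := 1 - 2 / n%:R.

(** At a vertex other than the marked one, the coin sees one arc with value [be]
    and [n - 1] arcs with value [ga], so twice their average is
    [(1 - c) be + (1 + c) ga]. *)
Lemma transition_class_vec al be ga : U *m class_vec al be ga =
  class_vec ((1 + c) * ga - c * be) (- al) ((1 - c) * be + c * ga).
Proof.
have n0 : n%:R != 0 :> C by rewrite pnatr_eq0 -lt0n.
rewrite transition_func_vec; apply: eq_func_vec => p.
have: tail p != head p by exact: (valP p).
rewrite sum_class_fun /class_fun /c.
rewrite -[head (flip p)]/(tail p) -[tail (flip p)]/(head p).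
move: (tail p) (head p) => u v.
rewrite -[n.+1.-1]/n -(mulr_natr al) -(mulr_natr ga).
move: n%:R n0 => t t0.
by case: (eqVneq u a) => [->|_]; case: (eqVneq v a) => [_|_] // _; field.
Qed.

(** The hypotheses say that [l] and [m] are the roots of [z^2 - (1 + c) z + 1].
    The eigenvector is proportional to [(U + 1) (U - m)] applied to the constant
    vector, which is its component along [l] up to a factor. *)
Lemma class_eigenvec l m : l + m = 1 + c -> l * m = 1 ->
  U *m class_vec l (- 1) (l - 1) = l *: class_vec l (- 1) (l - 1).
Proof.
move=> lm lm1; rewrite transition_class_vec class_vecZ.
have -> : c = l + m - 1 by rewrite lm; ring.
congr class_vec; ring: lm1.
Qed.

Lemma class_eigenvecN1 :
  U *m class_vec (1 + c) (1 + c) (c - 1) =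
  - 1 *: class_vec (1 + c) (1 + c) (c - 1).
Proof.
by rewrite transition_class_vec class_vecZ; congr class_vec; ring.
Qed.

(** Partial fractions: the coefficients come from evaluating the Lagrange
    polynomials of the nodes [l], [m], [-1] at the walk; the last denominator is
    [(- 1 - l) (- 1 - m)]. *)
Lemma class_vec_decomp l m : l + m = 1 + c -> l * m = 1 ->
  1 + l != 0 -> 1 + m != 0 -> l - m != 0 ->
  class_vec 1 1 1 =
    (2 / ((1 + l) * (l - m))) *: class_vec l (- 1) (l - 1)
  + (2 / ((1 + m) * (m - l))) *: class_vec m (- 1) (m - 1)
  + ((1 + l) * (1 + m))^-1 *: class_vec (1 + c) (1 + c) (c - 1).
Proof.
move=> lm lm1 l0 m0 lm0; rewrite !class_vecZ !class_vecD.
have -> : c = l + m - 1 by rewrite lm; ring.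
have ml0 : m - l != 0 by rewrite -opprB oppr_eq0.
congr class_vec; field: lm1; by rewrite ?ml0 ?lm0 ?l0 ?m0.
Qed.

Let amplitude : C := (((Num.sqrt (#|'I_n.+1| * n)%:R)^-1 : R)%:C)%C.

Lemma initial_state_class_vec :
  initial_state R X = amplitude *: class_vec 1 1 1.
Proof.
apply/matrixP => i j; rewrite !mxE /class_fun.
by repeat case: ifP => _; rewrite mulr1.
Qed.

Lemma sum_eigenproj_complete (W : nmodType) (phi : 'cV[C]_#|arc X| -> W) l m :
  l + m = 1 + c -> l * m = 1 -> 1 + l != 0 -> 1 + m != 0 -> l - m != 0 ->
  phi 0 = 0 ->
  \sum_(r <- eigenvalues U) phi (eigenproj U r *m initial_state R X) =
    phi (amplitude *: ((2 / ((1 + l) * (l - m))) *: class_vec l (- 1) (l - 1)))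
  + phi (amplitude *: ((2 / ((1 + m) * (m - l))) *: class_vec m (- 1) (m - 1)))
  + phi (amplitude *: (((1 + l) * (1 + m))^-1 *:
           class_vec (1 + c) (1 + c) (c - 1))).
Proof.
move=> lm lm1 l1 m1 l_neq_m phi0.
have ml : m != l by rewrite eq_sym -subr_eq0.
have Nl : (-1 == l) = false by rewrite eq_sym -addr_eq0 addrC (negPf l1).
have Nm : (-1 == m) = false by rewrite eq_sym -addr_eq0 addrC (negPf m1).
have uniq_s : uniq [:: l; m; -1].
  by rewrite /= !inE negb_or eq_sym ml eq_sym Nl eq_sym Nm.
have eigenZ r t x : U *m x = r *: x ->
    U *m (amplitude *: (t *: x)) = r *: (amplitude *: (t *: x)).
  by move=> Ux; rewrite -!scalemxAr Ux !scalerA mulrC mulrA.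
pose y r := amplitude *:
  if r == l then (2 / ((1 + l) * (l - m))) *: class_vec l (- 1) (l - 1)
  else if r == m then (2 / ((1 + m) * (m - l))) *: class_vec m (- 1) (m - 1)
  else ((1 + l) * (1 + m))^-1 *: class_vec (1 + c) (1 + c) (c - 1).
rewrite (@sum_eigenproj _ _ _ _ [:: l; m; -1] y) //.
- by rewrite !big_cons big_nil addr0 addrA /y !eqxx (negPf ml) Nl Nm.
- exact: transition_unitary.
- move=> r; rewrite !inE /y => /or3P[] /eqP->.
  + by rewrite eqxx; apply/eigenZ/(class_eigenvec lm lm1).
  + rewrite eqxx (negPf ml); apply/eigenZ/(@class_eigenvec m l).
      by rewrite addrC.
    by rewrite mulrC.
  + by rewrite Nl Nm; apply/eigenZ/class_eigenvecN1.
rewrite initial_state_class_vec (class_vec_decomp lm lm1) //.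
rewrite !big_cons big_nil addr0 [RHS]addrA /y !eqxx (negPf ml) Nl Nm.
by rewrite -!scalerDr.
Qed.

End CompleteGraph.

(** * The search probability in closed form *)

Section ExactProbability.
Variable R : realType.
Local Notation C := (R[i])%C.
Local Notation sqr_normc z := (Normc.normc z ^+ 2).

Lemma sqr_normcE (x y : R) : sqr_normc (x +i* y)%C = x ^+ 2 + y ^+ 2.
Proof. by rewrite sqr_sqrtr// addr_ge0 ?sqr_ge0. Qed.

Lemma sqr_normc_real (x : R) : sqr_normc (x%:C)%C = x ^+ 2.
Proof. by rewrite sqr_normcE expr0n addr0. Qed.

Lemma sqr_normc_gt0_neq0 (z : C) : 0 < sqr_normc z -> z != 0.
Proof. by apply: contraTneq => ->; rewrite Normc.normc0 expr0n ltxx. Qed.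

(** The eigenvalues [l] and [m] are the conjugate points of the unit circle with
    real part [x]; only the moduli listed here enter the probability. *)
Lemma unit_circle_point (x : R) : -1 < x < 1 -> exists l m : C,
  [/\ l + m = ((2 * x)%:C)%C, l * m = 1, sqr_normc l = 1 & sqr_normc m = 1] /\
  [/\ sqr_normc (1 + l) = 2 * (1 + x), sqr_normc (1 + m) = 2 * (1 + x),
      sqr_normc (l - m) = 4 * (1 - x ^+ 2) &
      sqr_normc (m - l) = 4 * (1 - x ^+ 2)].
Proof.
move=> x1; have : 0 < 1 - x ^+ 2 by nra.
move=> /ltW/sqr_sqrtr; set y := Num.sqrt _ => y2.
exists (x +i* y)%C, (x +i* - y)%C; split; split.
- by apply/eqP; rewrite eq_complex /=; apply/andP; split; apply/eqP; ring.
- by apply/eqP; rewrite eq_complex /=; apply/andP; split; apply/eqP; ring: y2.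
- by rewrite sqr_normcE; ring: y2.
- by rewrite sqr_normcE; ring: y2.
- rewrite (_ : 1 + _ = ((1 + x) +i* y)%C) ?sqr_normcE; first ring: y2.
  by apply/eqP; rewrite eq_complex /= add0r !eqxx.
- rewrite (_ : 1 + _ = ((1 + x) +i* - y)%C) ?sqr_normcE; first ring: y2.
  by apply/eqP; rewrite eq_complex /= add0r !eqxx.
- rewrite (_ : _ - _ = (0 +i* (2 * y))%C) ?sqr_normcE; first ring: y2.
  by apply/eqP; rewrite eq_complex /=; apply/andP; split; apply/eqP; ring.
- rewrite (_ : _ - _ = (0 +i* (- 2 * y))%C) ?sqr_normcE; first ring: y2.
  by apply/eqP; rewrite eq_complex /=; apply/andP; split; apply/eqP; ring.
Qed.

Variables (n : nat) (a : 'I_n.+1).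
Hypothesis n_gt0 : (0 < n)%N.
Local Notation X := (complete_graph n.+1).

Definition entry_prob (p : arc X) (v : 'cV[C]_#|arc X|) : R :=
  sqr_normc (((arc_vec R p)^T *m v) 0 0).

Lemma entry_prob_class p t z be ga : tail p == a ->
  entry_prob p (((Num.sqrt (#|'I_n.+1| * n)%:R)^-1%R)%:C%C *:
     (t *: class_vec a z be ga)) =
  (n.+1%:R * n%:R)^-1 * (sqr_normc t * sqr_normc z).
Proof.
move=> /eqP pa; rewrite /entry_prob -!scalemxAr 2!mxE class_vec_entry //.
rewrite !Normc.normcM !exprMn sqr_normc_real exprVn sqr_sqrtr //.
by rewrite card_ord natrM.
Qed.

Lemma entry_prob0 p : entry_prob p 0 = 0.
Proof. by rewrite /entry_prob mulmx0 mxE Normc.normc0 expr0n. Qed.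

(** Since [l] and [m] have modulus 1, the squared amplitudes along them depend
    only on the moduli of [1 + l], [1 + m] and [l - m], whose squares are
    polynomials in [h].  The final [1 / n] is the share of one of the [n] arcs
    leaving the marked vertex. *)
Lemma entry_prob_sum p (h := n%:R^-1 : R) : tail p == a ->
  \sum_(r <- eigenvalues (transition R X a))
    entry_prob p (eigenproj (transition R X a) r *m initial_state R X) =
  (1 + h * (1 - h) ^+ 2) / ((1 + h) * (2 - h) ^+ 2) / n%:R.
Proof.
have n0 : n%:R != 0 :> R by rewrite pnatr_eq0 -lt0n.
have h_gt0 : 0 < h by rewrite invr_gt0 ltr0n.
have h_le1 : h <= 1 by rewrite invf_le1 ?ltr0n // ler1n.
have n1E : n.+1%:R = n%:R * (1 + h) by rewrite /h mulrDr mulr1 divff // natr1.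
have cE : 1 + (1 - 2 / n%:R) = ((2 * (1 - h))%:C)%C :> C.
  rewrite rmorphM rmorphB rmorph1 fmorphV !rmorph_nat; ring.
have nE : n%:R = h^-1 by rewrite invrK.
clearbody h.
have [|l [m [[lm lm1 Nl Nm] [Nl1 Nm1 Nlm Nml]]]] := @unit_circle_point (1 - h).
  by lra.
have q1 : 0 < 2 * (1 + (1 - h)) by lra.
have q2 : 0 < 4 * (1 - (1 - h) ^+ 2) by nra.
have l1 : 1 + l != 0 by apply: sqr_normc_gt0_neq0; rewrite Nl1.
have m1 : 1 + m != 0 by apply: sqr_normc_gt0_neq0; rewrite Nm1.
have lm0 : l - m != 0 by apply: sqr_normc_gt0_neq0; rewrite Nlm.
move=> pa; rewrite -cE in lm.
rewrite (sum_eigenproj_complete a n_gt0 (phi := entry_prob p) lm lm1) //;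
  last exact: entry_prob0.
rewrite !entry_prob_class // cE sqr_normc_real.
rewrite !(Normc.normcM, Normc.normcV) !(exprMn, exprVn) Nl Nm Nl1 Nm1 Nlm Nml.
have -> : sqr_normc (2 : C) = 4.
  by rewrite -(rmorph_nat (real_complex R) 2) sqr_normc_real; ring.
rewrite n1E nE; clear -h_gt0 h_le1.
have [h0 h1 h2] : [/\ h != 0, 1 + h != 0 & 2 - h != 0] by split; lra.
by field; rewrite h0 h1 h2 gt_eqF //; nra.
Qed.

Lemma avg_search_prob_complete (h := n%:R^-1 : R) :
  avg_search_prob R X a =
  (1 + h * (1 - h) ^+ 2) / ((1 + h) * (2 - h) ^+ 2).
Proof.
pose P : R := (1 + h * (1 - h) ^+ 2) / ((1 + h) * (2 - h) ^+ 2).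
have entryE p : tail p == a ->
    \sum_(r <- eigenvalues (transition R X a))
      Normc.normc (((arc_vec R p)^T *m eigenproj (transition R X a) r
        *m initial_state R X) 0 0) ^+ 2 = P / n%:R.
  move=> pa; rewrite -(entry_prob_sum pa); apply: eq_bigr => r _.
  by rewrite /entry_prob mulmxA.
rewrite /avg_search_prob (eq_bigr _ entryE) big_const iter_addr_0 -sum1_card.
by rewrite card_arcs_from -[_ *+ _]mulr_natr divfK // pnatr_eq0 -lt0n.
Qed.

End ExactProbability.

(** * The limit *)

(* K_n is indexed as K_(n.+1), so that a marked vertex exists; the marked
   vertices a n are arbitrary. *)
Theorem theorem8p3 (R : realType) (a : forall n : nat, 'I_n.+1) :
  (fun n : nat => avg_search_prob R (complete_graph n.+1) (a n)) @ \oo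
    --> (4^-1 : R).
Proof.
(* The closed form needs an edge, so the one-vertex graph is dropped. *)
rewrite -cvg_shiftS /=.
have -> : (fun n => avg_search_prob R (complete_graph n.+2) (a n.+1)) =
    (fun h : R => (1 + h * (1 - h) ^+ 2) / ((1 + h) * (2 - h) ^+ 2))
      \o harmonic.
  by apply/funext => n; rewrite avg_search_prob_complete.
apply: (@cvg_comp _ _ _ _ _ _ (nbhs (0 : R))); first exact: cvg_harmonic.
have -> : 4^-1 = (1 + 0 * (1 - 0) ^+ 2) / ((1 + 0) * (2 - 0) ^+ 2) :> R.
  by field.
apply: cvgM.
  apply: cvgD; first exact: cvg_cst.
  apply: cvgM => //; apply: cvgM; apply: cvgB => //; exact: cvg_cst.
apply: cvgV; first by rewrite subr0 addr0 mul1r expf_neq0 // pnatr_eq0.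
apply: cvgM; first by apply: cvgD => //; exact: cvg_cst.
by apply: cvgM; apply: cvgB => //; exact: cvg_cst.
Qed.
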